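(* Let $E$ be a complete metric space, let $t_*\in\mathbb R\cup\{-\infty\}$, $\Omega=E\times(t_*,\infty)$, let $\le$ be a partial order on $\Omega$, let $\psi:\Omega\to\mathcal C(E)$ be monotonic, and let $a_*\ge 0$ be such that (MSG0) holds. Let $a>a_*$ and let $S_i\subset E$, $i\in\mathbb N$, be a sequence of $a$-winning sets of the $\psi$-modified Schmidt game. Then $\bigcap_{i=1}^\infty S_i$ is also $a$-winning.
   Context: $\mathcal C(E)$ is the set of nonempty compact subsets of $E$. Monotonic means: $\omega'\le\omega$ implies $\psi(\omega')\subset\psi(\omega)$. (MSG0): for any $(x,t)\in\Omega$ and any $s>a_*$ there exists $x'\in E$ with $(x',t+s)\le(x,t)$. The $\psi$-modified Schmidt game: for $a,b>a_*$, the $(a,b)$-game is played by Alice and Bob. Bob picks $\omega_1=(x_1,t_1)\in\Omega$; then for $k=1,2,\dots$, given $\omega_k=(x_k,t_k)$, Alice picks $x_k'\in E$ with $\omega_k'=(x_k',t_k+a)\le\omega_k$, and Bob picks $x_{k+1}\in E$ with $\omega_{k+1}=(x_{k+1},t_k+a+b)\le\omega_k'$, where $t_{k+1}=t_k+a+b$. A set $S\subset E$ is $(a,b)$-winning if Alice has a strategy guaranteeing that the (nonempty compact) set $\bigcap_{k}\psi(\omega_k)=\bigcap_k\psi(\omega_k')$ is contained in $S$ however Bob plays; $S$ is $a$-winning if it is $(a,b)$-winning for every $b>a_*$. *)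

(* Defs.v *)
From HB Require Import structures.
From mathcomp Require Import all_boot all_order all_algebra.
From mathcomp Require Import all_classical all_reals all_analysis.

Set Implicit Arguments.
Unset Strict Implicit.
Unset Printing Implicit Defensive.

Import Order.TTheory GRing.Theory Num.Theory.

Local Open Scope classical_set_scope.
Local Open Scope ring_scope.

(* The axiom of the library's [completeType], without the base point that
   [completeType] also requires: E may be empty. *)
Definition complete_space (E : uniformType) :=
  forall F : set_system E, ProperFilter F -> cauchy F -> exists x : E, F --> x.

(* Omega = E x (tstar, oo). The order, psi and the moves only make sense on
   Omega, so it is a type of its own. *)
Definition Omega (R : realType) (E : Type) (tstar : \bar R) :=
  {w : E * R | (tstar < w.2%:E)%E}.

Definition time (R : realType) (E : Type) (tstar : \bar R)
  (w : Omega E tstar) : R := (sval w).2.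

Section game.
Context {R : realType} {E : metricType R} {tstar : \bar R}.
Local Notation W := (Omega E tstar).
Implicit Types (le : rel W) (psi : W -> set E) (w : W).

Definition partial_order le :=
  [/\ reflexive le, antisymmetric le & transitive le].

Definition monotonic le psi :=
  forall w' w, le w' w -> psi w' `<=` psi w.

(* w' = (x', t + s) <= (x, t) = w; choosing w' amounts to choosing x' in E. *)
Definition move le (s : R) w w' := time w' = time w + s /\ le w' w.

Definition MSG0 le (astar : R) :=
  forall w (s : R), astar < s -> exists w', move le s w w'.

(* A strategy for Alice: sigma [:: omega_1; ...; omega_(k-1)] omega_k is her
   answer omega'_k to Bob's moves so far. The last move is a separate argument
   so that a strategy exists also when Omega is empty. *)
Definition strategy := seq W -> W -> W.

(* Indices are shifted by one: w k stands for omega_(k+1). *)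
Definition alice (sigma : strategy) (w : nat -> W) (k : nat) : W :=
  sigma (mkseq w k) (w k).

(* sigma has to answer legally as long as Bob has played legally, and the
   outcome has to lie in S whenever Bob plays legally throughout. *)
Definition winning_strategy le psi (a b : R) (S : set E) (sigma : strategy) :=
  forall w : nat -> W,
    (forall n,
       (forall k, (k < n)%N -> move le b (alice sigma w k) (w k.+1)) ->
       move le a (w n) (alice sigma w n)) /\
    ((forall k, move le b (alice sigma w k) (w k.+1)) ->
     \bigcap_k psi (w k) `<=` S).

Definition ab_winning le psi (a b : R) (S : set E) :=
  exists sigma : strategy, winning_strategy le psi a b S sigma.

Definition a_winning le psi (astar a : R) (S : set E) :=
  forall b : R, astar < b -> ab_winning le psi a b S.

End game.

(* Main.v *)
Require Import Defs.
From HB Require Import structures.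
From mathcomp Require Import all_boot all_order all_algebra.
From mathcomp Require Import all_classical all_reals all_analysis.
From mathcomp Require Import zify.

Set Implicit Arguments.
Unset Strict Implicit.
Unset Printing Implicit Defensive.

Import Order.TTheory GRing.Theory Num.Theory.

Local Open Scope classical_set_scope.
Local Open Scope ring_scope.

(** The proof is Schmidt's interleaving argument. Each round [k] is devoted to
    one target set: writing [k.+1 = 2 ^ i * (2 * j + 1)], round [k] is the
    [j]-th round devoted to [S i]. The rounds devoted to [S i] are thus spaced
    [2 ^ i.+1] apart, and everything that happens between two of them, namely
    an answer of Bob followed by [2 ^ i.+1 - 1] full rounds, composes by
    transitivity of [le] into a single move of duration
    [bi = b + (2 ^ i.+1 - 1) * (a + b)]. Hence what is seen at those rounds is
    a play of the [(a, bi)]-game. Since [bi >= b > astar], Alice owns a winning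
    strategy [sigma i] for that game and the target [S i]; in round [k] she
    answers as [sigma i] does to the moves of Bob in the earlier rounds devoted
    to [S i] ([alice_interleave]).

    Two points have to be checked. Alice's answers are legal
    ([interleave_legal]), although the moves ascribed to Bob in a subgame involve
    her own answers in the others. The outcome lies in every [S i]: the
    intersection of the [psi (w k)] over all rounds is contained in their
    intersection over the rounds devoted to [S i], which [sigma i] forces into
    [S i]. *)

(** The [- 1] makes [(i, j) |-> round i j] a bijection onto the rounds
    counted from 0. *)
Definition round (i j : nat) : nat := (2 ^ i * j.*2.+1).-1.

Definition subgame (k : nat) : nat := logn 2 k.+1.

Definition subround (k : nat) : nat := (k.+1 %/ 2 ^ subgame k)./2.

Lemma roundK k : round (subgame k) (subround k) = k.
Proof.
rewrite /round /subround /subgame; set i := logn 2 k.+1.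
have dvd_i : (2 ^ i %| k.+1)%N by exact: pfactor_dvdnn.
(* an even quotient would let [2 ^ i.+1] divide [k.+1] *)
have odd_q : odd (k.+1 %/ 2 ^ i).
  rewrite -[odd _]negbK -dvdn2 -(@dvdn_pmul2r (2 ^ i)%N) ?expn_gt0 //.
  by rewrite divnK // -expnS pfactor_dvdn // ltnn.
have -> : ((k.+1 %/ 2 ^ i)./2).*2.+1 = (k.+1 %/ 2 ^ i)%N.
  by rewrite -[RHS]odd_double_half odd_q.
by rewrite mulnC divnK.
Qed.

Lemma subgame_round i j : subgame (round i j) = i.
Proof.
rewrite /subgame /round prednK ?muln_gt0 ?expn_gt0 //.
rewrite lognM ?expn_gt0 // lognX logn_prime // eqxx muln1.
by rewrite lognE /= dvdn2 /= odd_double addn0.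
Qed.

Lemma subround_round i j : subround (round i j) = j.
Proof.
rewrite /subround subgame_round /round prednK ?muln_gt0 ?expn_gt0 //.
by rewrite mulKn ?expn_gt0 //= uphalf_double.
Qed.

Lemma roundS i j : round i j.+1 = ((round i j).+1 + (2 ^ i.+1).-1)%N.
Proof.
rewrite /round expnS; have : (0 < 2 ^ i)%N by rewrite expn_gt0.
by move: (2 ^ i)%N => e; nia.
Qed.

Lemma leq_round i j l : (j <= l)%N -> (round i j <= round i l)%N.
Proof.
by move=> jl; rewrite /round -!subn1 leq_sub2r // leq_mul // ltnS leq_double.
Qed.

Lemma ltn_round i j l : (j < l)%N -> (round i j < round i l)%N.
Proof. by move=> /(leq_round i); apply: leq_trans; rewrite roundS leq_addr. Qed.

Section interleaving.
Context {R : realType} {E : metricType R} {tstar : \bar R}.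
Local Notation W := (Omega E tstar).
Implicit Types (sigma : nat -> @strategy R E tstar) (w : nat -> W).

(** The default value [x] of [nth] is never reached: all rounds looked up
    precede the current one. *)
Definition interleave sigma : @strategy R E tstar := fun h x =>
  let i := subgame (size h) in
  sigma i (mkseq (fun l => nth x h (round i l)) (subround (size h))) x.

Lemma alice_interleave sigma w i j :
  alice (interleave sigma) w (round i j) = alice (sigma i) (w \o round i) j.
Proof.
rewrite /alice /interleave size_mkseq subgame_round subround_round.
congr (sigma i _ _); apply/eq_in_map => l; rewrite mem_iota /= => lj.
by rewrite nth_mkseq // ltn_round.
Qed.

Variable le : rel W.
Hypothesis le_order : partial_order le.

Lemma move_refl x : move le 0 x x.
Proof. by case: le_order => le_refl _ _; split; rewrite ?addr0. Qed.

Lemma move_trans s t x y z :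
  move le s x y -> move le t y z -> move le (s + t) x z.
Proof.
case: le_order => _ _ le_trans [ty yx] [tz zy]; split.
  by rewrite tz ty addrA.
exact: le_trans zy yx.
Qed.

Lemma move_iter s w m n :
  (forall k, (m <= k < m + n)%N -> move le s (w k) (w k.+1)) ->
  move le (s *+ n) (w m) (w (m + n)%N).
Proof.
elim: n => [_|n IHn ws]; first by rewrite mulr0n addn0; exact: move_refl.
rewrite mulrSr addnS; apply: move_trans (IHn _) (ws _ _).
  by move=> k /andP[mk kn]; apply: ws; rewrite mk addnS ltnS ltnW.
by rewrite leq_addr addnS /=.
Qed.

(** The time Bob is credited with in the [i]-th subgame. *)
Definition compound_time (a b : R) (i : nat) : R :=
  b + (a + b) *+ (2 ^ i.+1).-1.

(** Between two rounds of one subgame, Bob's reply and the full rounds that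
    follow amount to one move of Bob in the subgame. *)
Lemma subgame_move sigma w (a b : R) i l n :
  (round i l.+1 <= n)%N ->
  (forall k, (k < n)%N -> move le a (w k) (alice (interleave sigma) w k)) ->
  (forall k, (k < n)%N -> move le b (alice (interleave sigma) w k) (w k.+1)) ->
  move le (compound_time a b i)
    (alice (sigma i) (w \o round i) l) ((w \o round i) l.+1).
Proof.
move=> ln alice_ok bob_ok; rewrite -alice_interleave /= roundS.
apply: move_trans (bob_ok _ _) _.
  by apply: leq_trans ln; exact: ltn_round.
apply: move_iter => k; rewrite -roundS => /andP[_ kl].
have kn : (k < n)%N := leq_trans kl ln.
exact: move_trans (alice_ok _ kn) (bob_ok _ kn).
Qed.

(** Alice's earlier answers occur inside the moves ascribed to Bob in the
    current subgame, and [sigma i] answers legally only if those moves are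
    legal; hence the strong induction on the round. *)
Lemma interleave_legal psi (T : nat -> set E) sigma (a b : R) w n :
  (forall i, winning_strategy le psi a (compound_time a b i) (T i) (sigma i)) ->
  (forall k, (k < n)%N -> move le b (alice (interleave sigma) w k) (w k.+1)) ->
  move le a (w n) (alice (interleave sigma) w n).
Proof.
move=> sigmaP; elim/ltn_ind: n => n IHn bob_ok.
rewrite -(roundK n) alice_interleave.
set i := subgame n; set j := subround n.
apply: (sigmaP i (w \o round i)).1 => l lj.
apply: (@subgame_move _ _ _ _ _ _ n) => [|k kn|//].
  by rewrite -[leqRHS]roundK leq_round.
apply: IHn => // m mk.
exact: bob_ok (ltn_trans mk kn).
Qed.

Lemma interleave_winning psi (T : nat -> set E) sigma (a b : R) :
  (forall i, winning_strategy le psi a (compound_time a b i) (T i) (sigma i)) ->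
  winning_strategy le psi a b (\bigcap_i T i) (interleave sigma).
Proof.
move=> sigmaP w; split=> [n|bob_ok]; first exact: interleave_legal.
move=> x psi_x i _.
apply: (sigmaP i (w \o round i)).2 => [l|l _]; last exact: psi_x.
apply: (@subgame_move _ _ _ _ _ _ (round i l.+1)) => // k _.
by apply: interleave_legal sigmaP _ => m _; exact: bob_ok.
Qed.

End interleaving.

Theorem theorem2p4 (R : realType) (E : metricType R)
    (E_complete : complete_space E)
    (tstar : \bar R) (tstar_lt : (tstar < +oo)%E)
    (le : rel (Omega E tstar)) (le_order : partial_order le)
    (psi : Omega E tstar -> set E)
    (psi_compact : forall w, compact (psi w) /\ psi w !=set0)
    (psi_mono : monotonic le psi)
    (astar : R) (astar_ge0 : 0 <= astar) (msg0 : MSG0 le astar)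
    (a : R) (a_gt : astar < a)
    (S : nat -> set E) (S_winning : forall i, a_winning le psi astar a (S i)) :
  a_winning le psi astar a (\bigcap_i S i).
Proof.
move=> b b_gt.
have time_gt i : astar < compound_time a b i.
  apply: (lt_le_trans b_gt); rewrite lerDl mulrn_wge0 //.
  by rewrite addr_ge0 // (le_trans astar_ge0) // ltW.
have [sigma sigmaP] := choice (fun i => S_winning i _ (time_gt i)).
by exists (interleave sigma); exact: interleave_winning.
Qed.
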